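(* Let $A$ be a unital $C^{\ast}$-algebra with unit $1$, let $a, b \in A^+$, and set $\alpha = \max\{\Vert a\Vert, \Vert b\Vert\}$. Then $a$ is absolutely compatible with $b$, that is, $|a-b| + |a+b-\alpha 1| = \alpha 1$, if and only if $a \circ b = \alpha\,(a \dot\wedge b)$.
   Context: $A^+$ is the cone of positive elements of $A$. For $x \in A$, $|x| := (x^{\ast}x)^{1/2}$. For $a,b\in A$, $a \circ b := \frac12(ab + ba)$, and for self-adjoint $a,b$, $a \dot\wedge b := \frac12 (a + b - |a - b|)$. For positive elements $a,b$ and $\alpha = \max\{\Vert a\Vert,\Vert b\Vert\}$, $a$ and $b$ are called absolutely compatible if $|a-b| + |a+b-\alpha 1| = \alpha 1$. *)

(* Defs.v *)
From HB Require Import structures.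
From mathcomp Require Import all_boot all_order all_algebra.
From mathcomp Require Import boolp classical_sets reals topology normedtype.
From mathcomp Require Export complex.

Set Implicit Arguments.
Unset Strict Implicit.
Unset Printing Implicit Defensive.

Import Order.TTheory GRing.Theory Num.Theory numFieldNormedType.Exports.

Local Open Scope classical_set_scope.
Local Open Scope ring_scope.

(* The ring operations are fields of this mixin because Hierarchy Builder
   refuses a join of normed modules with rings placed below [Num.NumDomain]; the
   canonical ring structure is derived from them afterwards. The zero algebra is
   not excluded ([pzRingType], not [algType]). Norms take values in [R[i]]. *)
HB.mixin Record isCStarAlgebra (R : realType) A of CompleteNormedModule R[i] A
  := {
  cs_one : A ;
  cs_mul : A -> A -> A ;
  cs_mulA : associative cs_mul ;
  cs_mul1x : left_id cs_one cs_mul ;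
  cs_mulx1 : right_id cs_one cs_mul ;
  cs_mulDl : left_distributive cs_mul +%R ;
  cs_mulDr : right_distributive cs_mul +%R ;
  cs_scaleAl : forall (k : R[i]) (x y : A), k *: cs_mul x y = cs_mul (k *: x) y ;
  cs_scaleAr : forall (k : R[i]) (x y : A), k *: cs_mul x y = cs_mul x (k *: y) ;
  cs_normM : forall x y : A, `|cs_mul x y| <= `|x| * `|y| ;
  star : A -> A ;
  starD : forall x y : A, star (x + y) = star x + star y ;
  starZ : forall (k : R[i]) (x : A), star (k *: x) = k^* *: star x ;
  cs_starM : forall x y : A, star (cs_mul x y) = cs_mul (star y) (star x) ;
  starK : involutive star ;
  cs_normE : forall x : A, `|cs_mul (star x) x| = `|x| ^+ 2
}.

#[short(type="cstarAlgType")]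
HB.structure Definition CStarAlgebra (R : realType) :=
  {A of isCStarAlgebra R A & CompleteNormedModule R[i] A}.

HB.instance Definition _ (R : realType) (A : cstarAlgType R) :=
  GRing.Zmodule_isPzRing.Build (CStarAlgebra.sort A)
    (@cs_mulA R A) (@cs_mul1x R A) (@cs_mulx1 R A) (@cs_mulDl R A) (@cs_mulDr R A).

Section CStarAlgebraTheory.
Context {R : realType} {A : cstarAlgType R}.
Implicit Types (k : R[i]) (x y : A).

Lemma cstar_scaleAl k x y : k *: (x * y) = (k *: x) * y.
Proof. exact: cs_scaleAl. Qed.

Lemma cstar_scaleAr k x y : k *: (x * y) = x * (k *: y).
Proof. exact: cs_scaleAr. Qed.

Lemma cstar_normM x y : `|x * y| <= `|x| * `|y|.
Proof. exact: cs_normM. Qed.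

Lemma starM x y : star (x * y) = star y * star x.
Proof. exact: cs_starM. Qed.

Lemma cstar_normE x : `|star x * x| = `|x| ^+ 2.
Proof. exact: cs_normE. Qed.

Definition invertible x := exists y, x * y = 1 /\ y * x = 1.

Definition spectrum x : set R[i] := [set k : R[i] | ~ invertible (x - k *: (1 : A))].

Definition self_adjoint x := star x = x.

(* In [R[i]], [0 <= k] says that [k] is real and nonnegative. *)
Definition positive x := self_adjoint x /\ spectrum x `<=` [set k : R[i] | 0 <= k].

(* The positive square root, which exists and is unique for positive [x]; the
   default value 0 is never used there. *)
Definition psqrt x : A := xget 0 [set s | positive s /\ s ^+ 2 = x].

Definition absval x : A := psqrt (star x * x).

Definition jordan x y : A := (2^-1 : R[i]) *: (x * y + y * x).

Definition dotwedge x y : A := (2^-1 : R[i]) *: (x + y - absval (x - y)).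

(* Norms live in [R[i]], where [Num.max] is that of a partial order; norms are
   nonnegative reals, hence comparable. *)
Definition max_norm x y : R[i] := Num.max `|x| `|y|.

Definition abs_compatible x y :=
  absval (x - y) + absval (x + y - max_norm x y *: (1 : A)) = max_norm x y *: (1 : A).

End CStarAlgebraTheory.

(* Main.v *)
(* Put [u = a - b] and [v = a + b - alpha]. Expanding squares,
   [v^2 - (alpha - |u|)^2 = 4 (a o b - alpha (a /\ b))], and since
   [|u|] has norm [||u|| <= alpha], [alpha - |u|] is positive, so by uniqueness
   of positive square roots [|v| = alpha - |u|] if and only if
   [v^2 = (alpha - |u|)^2].

   The order theory is obtained without the spectral radius formula or the
   functional calculus. A self-adjoint [x] is called norm positive if
   [||t - x|| <= t] for some [t >= 0]. If [||x|| <= 1], then [1 - x] is the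
   square of [1 - y] for the limit [y] of the iteration [y := (x + y^2) / 2]. If
   [h^2 + c^2 = 1] with [h], [c] self-adjoint and commuting, then [h + i c] is
   unitary, so [||h|| <= 1]; hence squares of self-adjoint elements are norm
   positive, commuting products of norm positive elements are norm positive, and
   norm positive square roots are unique. Norm positivity
   coincides with spectral positivity. *)
Require Import Defs.
From mathcomp Require Import all_boot all_order all_algebra.
From mathcomp Require Import boolp classical_sets reals topology normedtype.
From mathcomp Require Import ring lra.

Set Implicit Arguments.
Unset Strict Implicit.
Unset Printing Implicit Defensive.

Import Order.TTheory GRing.Theory Num.Theory numFieldNormedType.Exports.
Local Open Scope ring_scope.

(** * The C*-norm as a real number, the involution, and real scalars *)

Section RealNorm.
Local Open Scope complex_scope.
Context {R : realType} {A : cstarAlgType R}.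
Implicit Types (x y z : A) (s t : R).

(** Norms are valued in [R[i]]; their real parts live in [R], where suprema and linear arithmetic
    apply. *)
Definition rnorm x : R := complex.Re `|x|.

Definition scal t : A := t%:C *: (1 : A).

Lemma rnormE x : `|x| = (rnorm x)%:C.
Proof. by rewrite /rnorm RRe_real // ger0_real. Qed.

Lemma rnorm_ge0 x : 0 <= rnorm x.
Proof. by rewrite -ler0c -rnormE. Qed.

Lemma rnormN x : rnorm (- x) = rnorm x.
Proof. by rewrite /rnorm normrN. Qed.

Lemma rnormB x y : rnorm (x - y) = rnorm (y - x).
Proof. by rewrite /rnorm distrC. Qed.

Lemma rnorm0 : rnorm 0 = 0.
Proof. by rewrite /rnorm normr0. Qed.

Lemma rnorm0_eq0 x : rnorm x = 0 -> x = 0.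
Proof. by move=> h; apply/normr0_eq0; rewrite rnormE h. Qed.

Lemma ler_rnormD x y : rnorm (x + y) <= rnorm x + rnorm y.
Proof. by rewrite -lecR rmorphD /= -!rnormE ler_normD. Qed.

Lemma ler_rnormM x y : rnorm (x * y) <= rnorm x * rnorm y.
Proof. by rewrite -lecR rmorphM /= -!rnormE cstar_normM. Qed.

Lemma rnorm_starM x : rnorm (star x * x) = rnorm x ^+ 2.
Proof. by apply: complexI; rewrite rmorphXn /= -!rnormE cstar_normE. Qed.

Lemma star0 : star (0 : A) = 0.
Proof. by apply: (addrI (star 0)); rewrite -starD !addr0. Qed.

Lemma starN x : star (- x) = - star x.
Proof. by apply/eqP; rewrite -addr_eq0 -starD addNr star0. Qed.

Lemma starB x y : star (x - y) = star x - star y.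
Proof. by rewrite starD starN. Qed.

Lemma star1 : star (1 : A) = 1.
Proof. by rewrite -[LHS]mulr1 -{2}[1 in LHS]starK -starM mulr1 starK. Qed.

(** The C*-identity gives [rnorm x ^+ 2 <= rnorm (star x) * rnorm x]; cancel [rnorm x]. *)
Lemma ler_rnorm_star x : rnorm x <= rnorm (star x).
Proof.
have [->|x0] := eqVneq (rnorm x) 0; first exact: rnorm_ge0.
have xp : 0 < rnorm x by rewrite lt_neqAle eq_sym x0 rnorm_ge0.
by rewrite -(ler_pM2r xp) -expr2 -rnorm_starM ler_rnormM.
Qed.

Lemma rnorm_star x : rnorm (star x) = rnorm x.
Proof.
by apply/eqP; rewrite eq_le ler_rnorm_star -{2}(starK x) ler_rnorm_star.
Qed.

Lemma rnorm_sqr x : self_adjoint x -> rnorm (x * x) = rnorm x ^+ 2.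
Proof. by move=> sx; rewrite -rnorm_starM sx. Qed.

Lemma sqr_sa_eq0 x : self_adjoint x -> x * x = 0 -> x = 0.
Proof.
move=> sx xx; apply: rnorm0_eq0; apply/eqP.
by rewrite -sqrf_eq0 -rnorm_sqr // xx rnorm0.
Qed.

(** The norm of [1] equals its own square; it is 0 in the zero algebra, whence only an
    inequality. *)
Lemma rnorm1 : rnorm 1 <= 1.
Proof.
have := @rnorm_sqr 1 star1; rewrite mulr1.
by have := rnorm_ge0 1; nra.
Qed.

Lemma scalE t x : scal t * x = t%:C *: x.
Proof. by rewrite /scal -cstar_scaleAl mul1r. Qed.

Lemma scalC t x : x * scal t = scal t * x.
Proof. by rewrite scalE /scal -cstar_scaleAr mulr1. Qed.

Lemma scalD s t : scal (s + t) = scal s + scal t.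
Proof. by rewrite /scal rmorphD scalerDl. Qed.

Lemma scalM s t : scal (s * t) = scal s * scal t.
Proof. by rewrite scalE /scal scalerA rmorphM. Qed.

Lemma scal0 : scal 0 = 0. Proof. by rewrite /scal scale0r. Qed.

Lemma scal1 : scal 1 = 1. Proof. by rewrite /scal scale1r. Qed.

Lemma scalN t : scal (- t) = - scal t.
Proof. by rewrite /scal rmorphN scaleNr. Qed.

Lemma scalB s t : scal (s - t) = scal s - scal t.
Proof. by rewrite scalD scalN. Qed.

Lemma star_scal t : star (scal t) = scal t.
Proof.
by rewrite /scal starZ star1 (CrealP _) //; apply/complex_realP; exists t.
Qed.

Lemma rnorm_scalM t x : rnorm (scal t * x) = `|t| * rnorm x.
Proof.
apply: complexI; rewrite -rnormE scalE normrZ rnormE rmorphM; congr (_ * _).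
by rewrite normc_def /= expr0n /= addr0 sqrtr_sqr.
Qed.

Lemma rnorm_scal t : rnorm (scal t) <= `|t|.
Proof.
by rewrite -[scal t]mulr1 rnorm_scalM ler_piMr // rnorm1.
Qed.

Lemma scalKV t x : t != 0 -> scal t * (scal t^-1 * x) = x.
Proof. by move=> t0; rewrite mulrA -scalM mulfV // scal1 mul1r. Qed.

Lemma scal_mulACA s t x y :
  (scal s * x) * (scal t * y) = scal (s * t) * (x * y).
Proof. by rewrite scalM -mulrA [x * _]mulrA scalC -!mulrA. Qed.

Lemma comm_scal t x : GRing.comm x (scal t).
Proof. exact: scalC. Qed.

End RealNorm.

(** * Limits of sequences in the algebra *)

Section Limits.
Local Open Scope complex_scope.
Context {R : realType} {A : cstarAlgType R}.
Implicit Types (x y z : A) (s t : R).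

Definition rnorm_cvg (u : nat -> A) (l : A) : Prop :=
  forall e : R, 0 < e ->
    exists N, forall n, (N <= n)%N -> rnorm (l - u n) <= e.

(** The real sequence [s] is nondecreasing and bounded, hence Cauchy; telescoping carries this over
    to [u], and completeness gives the limit. *)
Lemma dominated_cvg (u : nat -> A) (s : nat -> R) (B : R) :
  (forall n, rnorm (u n.+1 - u n) <= s n.+1 - s n) ->
  (forall n, s n <= B) -> exists l, rnorm_cvg u l.
Proof.
move=> us sB.
have usD n k : rnorm (u (k + n)%N - u n) <= s (k + n)%N - s n.
  elim: k => [|k IH]; first by rewrite add0n !subrr rnorm0.
  have -> : u (k.+1 + n)%N - u n =
            (u (k + n).+1 - u (k + n)%N) + (u (k + n)%N - u n).
    by rewrite addrA subrK addSn.
  by have := ler_rnormD (u (k + n).+1 - u (k + n)%N) (u (k + n)%N - u n);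
     have := us (k + n)%N; rewrite addSn; lra.
have sup_s : has_sup (range s).
  split; first by exists (s 0%N); exists 0%N.
  by exists B => _ [n _ <-].
have cauchy_u : cauchy (u @ \oo)%classic.
  apply: cauchy_exP => eps eps0.
  have epsR : eps = (complex.Re eps)%:C by rewrite RRe_real // gtr0_real.
  have e0 : 0 < complex.Re eps by rewrite -ltcR -epsR.
  have [_ [N _ <-] sN] := sup_adherent e0 sup_s.
  exists (u N); exists N => //= n Nn; rewrite -ball_normE /=.
  rewrite rnormE epsR ltcR rnormB -(subnK Nn).
  have := usD N (n - N)%N.
  have : s (n - N + N)%N <= sup (range s).
    by apply: ub_le_sup; [case: sup_s | exists (n - N + N)%N].
  by lra.
have /cauchy_cvgP/cvg_ex[l ul] := cauchy_u.
exists l => e e0.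
have /cvgrPdist_le/(_ e%:C) := ul.
by rewrite ltcR => /(_ e0) [N _ HN]; exists N => n /HN; rewrite rnormE lecR.
Qed.

(** Passes an equation to the limit, [z] being its defect at [l]. Two consecutive errors appear
    because a recursion links [u n] and [u n.+1]. *)
Lemma rnorm_cvg_eq0 (u : nat -> A) (l z : A) (C : R) : rnorm_cvg u l ->
  (forall n, rnorm z <= C * (rnorm (l - u n) + rnorm (l - u n.+1))) -> z = 0.
Proof.
move=> ul zC; apply: rnorm0_eq0; apply/eqP; rewrite eq_le rnorm_ge0 andbT.
apply/ler_addgt0Pr => e e0; rewrite add0r.
have K0 : 0 < 2 * (`|C| + 1) by have := normr_ge0 C; lra.
have [N /[dup] /(_ N (leqnn N)) h1 /(_ N.+1 (leqnSn N)) h2] :=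
  ul _ (divr_gt0 e0 K0).
apply: (le_trans (zC N)).
set d := e / _ in h1 h2.
have -> : e = (`|C| + 1) * (d + d).
  by rewrite /d; field; rewrite gt_eqF //; have := normr_ge0 C; lra.
apply: (@le_trans _ _ ((`|C| + 1) * (rnorm (l - u N) + rnorm (l - u N.+1)))).
  by rewrite ler_wpM2r ?addr_ge0 ?rnorm_ge0 //; have := ler_norm C; lra.
by rewrite ler_wpM2l ?lerD //; have := normr_ge0 C; lra.
Qed.
End Limits.

(** * Square identities in a noncommutative ring *)

Lemma mulrBD_comm (T : pzRingType) (x y : T) : GRing.comm x y ->
  (x - y) * (x + y) = x * x - y * y.
Proof. by move=> xy; rewrite mulrDr !mulrBl -(xy : _ * _ = _) addrA subrK. Qed.

Lemma sqrB_comm (T : pzRingType) (x y : T) : GRing.comm x y ->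
  (x - y) * (x - y) = x * x + y * y - (x * y + x * y).
Proof.
move=> xy; rewrite mulrBl !mulrBr -(xy : _ = _) opprB addrACA.
by rewrite -opprD.
Qed.

Lemma sqrD_sqrB (T : pzRingType) (x y : T) :
  (x + y) * (x + y) =
  (x - y) * (x - y) + ((x * y + y * x) + (x * y + y * x)).
Proof.
rewrite mulrDl mulrBl !mulrDr !mulrN opprB [y * x + _]addrC addrACA.
by rewrite [x * x - _ + _]addrACA -opprD [in RHS]addrA subrK.
Qed.

(** * Square roots and norm positivity *)

Section SquareRoots.
Context {R : realType} {A : cstarAlgType R}.
Implicit Types (c g h p s x y z : A) (t : R).

Lemma comm_sqr x y : GRing.comm x y -> GRing.comm x (y * y).
Proof. by move=> xy; apply: commrM. Qed.

Lemma scal_halfD x : scal 2^-1 * x + scal 2^-1 * x = x.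
Proof.
by rewrite -mulrDl -scalD -[RHS]mul1r -scal1; congr (scal _ * _); field.
Qed.

Lemma rnorm_cvg_comm (u : nat -> A) (l c : A) : rnorm_cvg u l ->
  (forall n, GRing.comm c (u n)) -> GRing.comm c l.
Proof.
move=> ul cu; apply/eqP; rewrite -subr_eq0; apply/eqP.
apply: (@rnorm_cvg_eq0 _ _ u l _ (2 * rnorm c) ul) => n.
have -> : c * l - l * c = c * (l - u n) - (l - u n) * c.
  by rewrite mulrBr mulrBl -(cu n : _ = _) opprB addrA subrK.
have := ler_rnormD (c * (l - u n)) (- ((l - u n) * c)); rewrite rnormN.
have := ler_rnormM c (l - u n); have := ler_rnormM (l - u n) c.
have := rnorm_ge0 c; have := rnorm_ge0 (l - u n.+1).
by nra.
Qed.

Lemma rnorm_cvg_sa (u : nat -> A) (l : A) : rnorm_cvg u l ->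
  (forall n, self_adjoint (u n)) -> self_adjoint l.
Proof.
move=> ul su; apply/eqP; rewrite -subr_eq0; apply/eqP.
apply: (@rnorm_cvg_eq0 _ _ u l _ 2 ul) => n.
have -> : star l - l = star (l - u n) - (l - u n).
  by rewrite starB (su n) opprB addrA subrK.
have := ler_rnormD (star (l - u n)) (- (l - u n)); rewrite rnormN rnorm_star.
by have := rnorm_ge0 (l - u n.+1); lra.
Qed.

Lemma rnorm_cvg_le (u : nat -> A) (l : A) B : rnorm_cvg u l ->
  (forall n, rnorm (u n) <= B) -> rnorm l <= B.
Proof.
move=> ul uB; apply/ler_addgt0Pr => e /ul[N /(_ N (leqnn N)) h].
have := ler_rnormD (l - u N) (u N); rewrite subrK.
by have := uB N; lra.
Qed.

(* The iterates [u n] are polynomials in [x] with nonnegative coefficients, so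
   the same iteration started from the number 1 dominates them. *)
Lemma sqrt_one_sub x : self_adjoint x -> rnorm x <= 1 ->
  exists y, [/\ self_adjoint y, rnorm y <= 1,
    forall c, GRing.comm c x -> GRing.comm c y & (1 - y) * (1 - y) = 1 - x].
Proof.
move=> sx x1.
pose u n := iter n (fun y => scal 2^-1 * (x + y * y)) (0 : A).
(* The scalar iteration with [x] replaced by 1: its fixed point 1 keeps it in [0, 1]. *)
pose s n := iter n (fun t : R => 2^-1 * (1 + t * t)) 0.
have uS n : u n.+1 = scal 2^-1 * (x + u n * u n) by [].
have sS n : s n.+1 = 2^-1 * (1 + s n * s n) by [].
have s01 n : 0 <= s n <= 1.
  by elim: n => [|n IH]; rewrite ?sS; [rewrite /s /= ; lra | nra].
have u_comm c n : GRing.comm c x -> GRing.comm c (u n).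
  move=> cx; elim: n => [|n IH]; first exact: commr0.
  rewrite uS; apply: commrM; first exact: comm_scal.
  by apply: commrD => //; apply: comm_sqr.
have u_sa n : self_adjoint (u n).
  elim: n => [|n IH]; first exact: star0.
  by rewrite uS /self_adjoint starM star_scal starD starM sx IH scalC.
have u_le n : rnorm (u n) <= s n.
  elim: n => [|n IH]; first by rewrite /u /= rnorm0.
  rewrite uS sS rnorm_scalM ger0_norm ?invr_ge0 // ler_wpM2l ?invr_ge0 //.
  have := ler_rnormD x (u n * u n); have := ler_rnormM (u n) (u n).
  by have := rnorm_ge0 (u n); nra.
have u_comm2 n m : GRing.comm (u n) (u m).
  by apply/(u_comm _ m)/commr_sym/(u_comm _ n)/commr_refl.
have du n : rnorm (u n.+1 - u n) <= s n.+1 - s n.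
  elim: n => [|n IH].
    rewrite uS sS /u /s /= mulr0 !addr0 !subr0 rnorm_scalM mulr0 addr0.
    by rewrite ger0_norm ?invr_ge0 // ler_wpM2l ?invr_ge0.
  have -> : u n.+2 - u n.+1 = scal 2^-1 * ((u n.+1 - u n) * (u n.+1 + u n)).
    rewrite mulrBD_comm // [u n.+2]uS {2}[u n.+1]uS -mulrBr; congr (_ * _).
    by rewrite opprD addrACA subrr add0r.
  rewrite rnorm_scalM ger0_norm ?invr_ge0 // [s n.+2]sS {3}[s n.+1]sS.
  rewrite -mulrBr ler_wpM2l ?invr_ge0 // opprD addrACA subrr add0r -mulrBD_comm;
    last exact: mulrC.
  apply: le_trans (ler_rnormM _ _) _; apply: ler_pM; rewrite ?rnorm_ge0 //.
  by apply: le_trans (ler_rnormD _ _) _; rewrite lerD.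
have [l ul] : exists l, rnorm_cvg u l.
  by apply: (@dominated_cvg _ _ u s 1) => // n; case/andP: (s01 n).
have l1 : rnorm l <= 1.
  by apply: (rnorm_cvg_le ul) => n; apply: le_trans (u_le n) _; case/andP: (s01
    n).
have l_comm c : GRing.comm c x -> GRing.comm c l.
  by move=> cx; apply: (rnorm_cvg_comm ul) => n; apply: u_comm.
exists l; split=> //; first exact: (rnorm_cvg_sa ul).
(* The limit is a fixed point of the iteration, which amounts to [(1 - l) * (1 - l) = 1 - x]. *)
have lE : l = scal 2^-1 * (x + l * l).
  apply/eqP; rewrite -subr_eq0; apply/eqP; apply: (@rnorm_cvg_eq0 _ _ u l _ 2
    ul) => n.
  have lu : GRing.comm l (u n).
    by apply/u_comm/commr_sym/l_comm.
  have -> : l - scal 2^-1 * (x + l * l) =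
    (l - u n.+1) - scal 2^-1 * ((l - u n) * (l + u n)).
    rewrite mulrBD_comm // -[RHS]addrA -opprD uS -mulrDr -addrA.
    by rewrite [u n * _ + _]addrC subrK.
  have := ler_rnormD (l - u n.+1) (- (scal 2^-1 * ((l - u n) * (l + u n)))).
  rewrite rnormN rnorm_scalM ger0_norm ?invr_ge0 //.
  have lu2 : rnorm (l + u n) <= 2.
    by have := ler_rnormD l (u n); have := u_le n; have := s01 n; lra.
  have := ler_rnormM (l - u n) (l + u n).
  have := ler_wpM2l (rnorm_ge0 (l - u n)) lu2.
  by have := rnorm_ge0 (l - u n); have := rnorm_ge0 (l - u n.+1); lra.
rewrite mulrBl mul1r mulrBr mulr1 opprB addrA.
have -> : x = l + l - l * l by rewrite {1 2}lE scal_halfD addrK.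
by rewrite opprB opprD !addrA [1 - l + _]addrAC.
Qed.

Lemma rnorm_cos_le (h c : A) t : self_adjoint h -> self_adjoint c ->
  GRing.comm h c -> 0 <= t -> h * h + c * c = scal (t * t) -> rnorm h <= t.
Proof.
move=> sh sc hc t0 hct.
(* [h + i c] is [t] times a unitary *)
pose u := h + 'i *: c.
have suE : star u = h - 'i *: c.
  by rewrite starD starZ sh sc conjCi scaleNr.
have uu : star u * u = scal (t * t).
  rewrite suE mulrBD_comm; last by rewrite /GRing.comm -cstar_scaleAr hc
    cstar_scaleAl.
  by rewrite -cstar_scaleAl -cstar_scaleAr scalerA -['i * _]expr2 sqrCi
    scaleN1r opprK.
have ut : rnorm u <= t.
  have : rnorm u ^+ 2 <= t * t.
    by rewrite -rnorm_starM uu -[leRHS]ger0_norm ?mulr_ge0 // rnorm_scal.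
  by rewrite -expr2 ler_pXn2r // nnegrE ?rnorm_ge0.
(* [h] is the real part of [u]. *)
have hE : h = scal 2^-1 * (u + star u).
  by rewrite suE /u addrACA subrr addr0 mulrDr scal_halfD.
rewrite hE rnorm_scalM ger0_norm ?invr_ge0 //.
by have := ler_rnormD u (star u); rewrite rnorm_star; lra.
Qed.

(** For a real number the condition says [0 <= x <= 2 * t]: positivity expressed by the norm
    alone. *)
Definition norm_positive x :=
  self_adjoint x /\ exists2 t, 0 <= t & rnorm (scal t - x) <= t.

Lemma self_adjoint_scal t : self_adjoint (scal t : A).
Proof. exact: star_scal. Qed.

Lemma self_adjointM x y : self_adjoint x -> self_adjoint y ->
  GRing.comm x y -> self_adjoint (x * y).
Proof. by move=> sx sy xy; rewrite /self_adjoint starM sx sy xy. Qed.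

Lemma self_adjointD x y :
  self_adjoint x -> self_adjoint y -> self_adjoint (x + y).
Proof. by move=> sx sy; rewrite /self_adjoint starD sx sy. Qed.

Lemma self_adjointB x y :
  self_adjoint x -> self_adjoint y -> self_adjoint (x - y).
Proof. by move=> sx sy; rewrite /self_adjoint starB sx sy. Qed.

(** For [t > 0], rescale to [x = h / t]. Then [1 - x * x] is the square of [1 - y], and [1 - y] and
    [x] play cosine and sine, so [1 - y] and its square have norm at most 1. *)
Lemma rnorm_scal_sub_sqr h t : self_adjoint h -> rnorm h <= t ->
  rnorm (scal (t * t) - h * h) <= t * t.
Proof.
move=> sh ht; have t0 : 0 <= t by apply: le_trans ht; apply: rnorm_ge0.
move: t0; rewrite le_eqVlt => /orP[/eqP t0|t0].
  move: ht; rewrite -t0 => h0; have -> : h = 0.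
    by apply: rnorm0_eq0; apply/eqP; rewrite eq_le h0 rnorm_ge0.
  by rewrite !mulr0 scal0 subrr rnorm0.
have tn0 : t != 0 by rewrite gt_eqF.
pose x := scal t^-1 * h.
have sx : self_adjoint x.
  by apply: self_adjointM => //; [exact: self_adjoint_scal | rewrite
    /GRing.comm scalC].
have hE : h * h = scal (t * t) * (x * x).
  by rewrite /x scal_mulACA -invfM scalKV // mulf_neq0.
have x1 : rnorm x <= 1.
  by rewrite rnorm_scalM ger0_norm ?invr_ge0 ?(ltW t0) // ler_pdivrMl // mulr1.
have xx1 : rnorm (x * x) <= 1.
  by rewrite rnorm_sqr // expr_le1 // rnorm_ge0.
have [y [sy y1 yC yE]] := sqrt_one_sub (self_adjointM sx sx erefl) xx1.
have s1y : self_adjoint (1 - y) by apply: self_adjointB => //; exact: star1.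
have cx : GRing.comm (1 - y) x.
  apply/commr_sym/commrB; first exact: commr1.
  by apply: yC; apply: comm_sqr.
have c1 : rnorm (1 - y) <= 1.
  by apply: (rnorm_cos_le s1y sx cx) => //; rewrite yE subrK mulr1 scal1.
rewrite hE -{1}[scal (t * t)]mulr1 -mulrBr -yE rnorm_scalM.
rewrite ger0_norm ?mulr_ge0 ?(ltW t0) // ler_piMr ?mulr_ge0 ?(ltW t0) //.
by rewrite rnorm_sqr // expr_le1 // rnorm_ge0.
Qed.

Lemma norm_positive_sqr h : self_adjoint h -> norm_positive (h * h).
Proof.
move=> sh; split; first exact: self_adjointM.
exists (rnorm h * rnorm h); first by rewrite mulr_ge0 ?rnorm_ge0.
exact: rnorm_scal_sub_sqr.
Qed.

(** For [t > 0], [z = 1 - x / t] has norm at most 1, so [1 - z = x / t] has a root, to be rescaled.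
    The last clause makes roots of commuting elements commute. *)
Lemma norm_positive_sqrt x : norm_positive x -> exists s,
  [/\ norm_positive s, s * s = x & forall c, GRing.comm c x -> GRing.comm c s].
Proof.
move=> [sx [t]]; rewrite le_eqVlt => /orP[/eqP<-|t0] xt.
  have x0 : x = 0.
    apply: rnorm0_eq0; apply/eqP; rewrite eq_le rnorm_ge0 andbT.
    by move: xt; rewrite scal0 sub0r rnormN.
  exists 0; rewrite x0 mulr0; split=> //; rewrite -(mulr0 0).
  by apply: norm_positive_sqr; exact: star0.
have tn0 : t != 0 by rewrite gt_eqF.
pose z := 1 - scal t^-1 * x.
have zE : z = scal t^-1 * (scal t - x).
  by rewrite mulrBr -scalM mulVf // scal1.
have sz : self_adjoint z.
  apply: self_adjointB; first exact: star1.
  by apply: self_adjointM => //; [exact: self_adjoint_scal | rewrite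
    /GRing.comm scalC].
have z1 : rnorm z <= 1.
  by rewrite zE rnorm_scalM ger0_norm ?invr_ge0 ?(ltW t0) // ler_pdivrMl //
    mulr1.
have [y [sy y1 yC yE]] := sqrt_one_sub sz z1.
have s0 := sqrtr_ge0 t.
exists (scal (Num.sqrt t) * (1 - y)); split.
- split.
    apply: self_adjointM; [exact: self_adjoint_scal | | by rewrite /GRing.comm
      scalC].
    by apply: self_adjointB => //; exact: star1.
  exists (Num.sqrt t) => //.
  rewrite mulrBr mulr1 opprB addrC subrK rnorm_scalM ger0_norm //.
  by rewrite ler_piMr.
- rewrite scal_mulACA yE -expr2 sqr_sqrtr ?(ltW t0) //.
  by rewrite opprB addrC subrK scalKV.
- move=> c cx; apply: commrM; first exact: comm_scal.
  apply: commrB; first exact: commr1.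
  apply: yC; apply: commrB; first exact: commr1.
  by apply: commrM => //; exact: comm_scal.
Qed.

Lemma norm_positiveD x y :
  norm_positive x -> norm_positive y -> norm_positive (x + y).
Proof.
move=> [sx [s s0 xs]] [sy [t t0 yt]]; split; first exact: self_adjointD.
exists (s + t); first exact: addr_ge0.
rewrite scalD opprD addrACA.
by apply: le_trans (ler_rnormD _ _) _; exact: lerD.
Qed.

Lemma norm_positive_scal t : 0 <= t -> norm_positive (scal t : A).
Proof.
move=> t0; split; first exact: self_adjoint_scal.
by exists t => //; rewrite subrr rnorm0.
Qed.

Lemma norm_positive_scal_sub x t : self_adjoint x -> rnorm x <= t ->
  norm_positive (scal t - x).
Proof.
move=> sx xt; split; first by apply: self_adjointB => //; exact:
  self_adjoint_scal.
exists t; first by apply: le_trans xt; exact: rnorm_ge0.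
by rewrite opprB addrC subrK.
Qed.

(** The roots [r] and [s] of the factors commute, so the product is the square of [r * s]. *)
Lemma norm_positiveM x y : norm_positive x -> norm_positive y ->
  GRing.comm x y -> norm_positive (x * y).
Proof.
move=> /norm_positive_sqrt[r [[sr _] rE rC]] /norm_positive_sqrt[s [[ss _] sE
  sC]] xy.
have rs : GRing.comm r s by apply/commr_sym/rC/commr_sym/sC.
have -> : x * y = (r * s) * (r * s).
  by rewrite -rE -sE -!mulrA [s * (r * s)]mulrA -rs !mulrA.
by apply: norm_positive_sqr; apply: self_adjointM.
Qed.

(** The roots [h] of [x] and [c] of [scal t - x] commute, and [h * h + c * c = scal t]: cosine and
    sine with radius the square root of [t]. *)
Lemma norm_positive_le x t : 0 <= t -> norm_positive x ->
  norm_positive (scal t - x) -> rnorm x <= t.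
Proof.
move=> t0 /norm_positive_sqrt[h [[sh _] hE hC]] /norm_positive_sqrt[c [[sc _]
  cE cC]].
have hx : GRing.comm h x by rewrite -hE; apply: comm_sqr.
have hc : GRing.comm h c by apply: cC; apply: commrB => //; exact: comm_scal.
have ht : rnorm h <= Num.sqrt t.
  apply: (rnorm_cos_le sh sc hc); rewrite ?sqrtr_ge0 //.
  by rewrite hE cE addrC subrK -expr2 sqr_sqrtr.
by rewrite -hE rnorm_sqr // -(sqr_sqrtr t0) ler_pXn2r // nnegrE ?rnorm_ge0
  ?sqrtr_ge0.
Qed.

(** Every bound of the norm is thus a witness of norm positivity, so witnesses can be chosen
    uniformly. *)
Lemma rnorm_scal_sub x t :
  norm_positive x -> rnorm x <= t -> rnorm (scal t - x) <= t.
Proof.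
move=> /norm_positive_sqrt[h [[sh _] hE _]] xt.
have t0 : 0 <= t by apply: le_trans xt; exact: rnorm_ge0.
have := @rnorm_scal_sub_sqr h (Num.sqrt t) sh.
rewrite -!expr2 sqr_sqrtr // expr2 hE; apply.
by rewrite -(ler_pXn2r (isT : (0 < 2)%N)) ?nnegrE ?rnorm_ge0 ?sqrtr_ge0 //
   sqr_sqrtr // -rnorm_sqr // hE.
Qed.

Lemma norm_positive_anti x : norm_positive x -> norm_positive (- x) -> x = 0.
Proof.
move=> px pNx; apply: rnorm0_eq0; apply/eqP; rewrite eq_le rnorm_ge0 andbT.
by apply: norm_positive_le; rewrite ?scal0 ?sub0r.
Qed.

(** For [d = x - y], the norm positive elements [d * d * x] and [d * d * y] add up to
    [d * (x * x - y * y) = 0], so both vanish. Then [d ^+ 3 = 0], and the C*-identity, applied twice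
    to [d ^+ 4 = 0], gives [d = 0]. *)
Lemma sqrt_uniq_comm x y : norm_positive x -> norm_positive y ->
  GRing.comm x y -> x * x = y * y -> x = y.
Proof.
move=> px py xy xxyy; have [sx _] := px; have [sy _] := py.
pose d := x - y.
have sd : self_adjoint d by apply: self_adjointB.
have dx : GRing.comm d x.
  by apply/commr_sym/commrB; first exact: commr_refl.
have dy : GRing.comm d y.
  by apply/commr_sym/commrB; [exact: commr_sym | exact: commr_refl].
have pdd := norm_positive_sqr sd.
have pM z : norm_positive z -> GRing.comm d z -> norm_positive (d * d * z).
  by move=> pz dz; apply: norm_positiveM => //;
    apply/commr_sym/comm_sqr/commr_sym.
have dd0 : d * d * y + d * d * x = 0.
  by rewrite -mulrDr -mulrA [y + x]addrC mulrBD_comm // xxyy subrr mulr0.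
have ddy : d * d * y = 0.
  apply: norm_positive_anti; first exact: pM.
  by rewrite -[- _]addr0 -dd0 addKr; apply: pM.
have ddx : d * d * x = 0 by rewrite ddy add0r in dd0.
have ddd : d * d * d = 0 by rewrite {3}/d mulrBr ddx ddy subrr.
apply/eqP; rewrite -subr_eq0 -/d; apply/eqP.
apply: sqr_sa_eq0 => //; apply: sqr_sa_eq0; first exact: self_adjointM.
by rewrite mulrA ddd mul0r.
Qed.

(** Both are compared with the root [s] built for [x * x], which commutes with each of them since
    each commutes with its square. *)
Lemma sqrt_uniq x y :
  norm_positive x -> norm_positive y -> x * x = y * y -> x = y.
Proof.
move=> px py xxyy; have [sx _] := px.
have [s [ps sE sC]] := norm_positive_sqrt (norm_positive_sqr sx).
transitivity s; last apply: sqrt_uniq_comm; rewrite -?xxyy //.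
  apply: sqrt_uniq_comm => //.
  by apply: sC; apply: comm_sqr.
by apply/commr_sym/sC; rewrite xxyy; apply: comm_sqr.
Qed.

(** With [G = rnorm g + 1] for the inverse [g], [p - 1 / G] is [(G - g) * p / G], a product of
    commuting norm positive elements. Adding 1 keeps [G] positive even in the zero algebra. *)
Lemma norm_positive_decr p : norm_positive p -> invertible p ->
  exists2 e, 0 < e & norm_positive (p - scal e).
Proof.
move=> pp [g [pg gp]]; have [sp _] := pp.
have [q [[sq _] qE _]] := norm_positive_sqrt pp.
have sg : self_adjoint g.
  by rewrite /self_adjoint -[LHS]mulr1 -pg mulrA -{1}sp -starM pg star1 mul1r.
have G0 : 0 < rnorm g + 1 by have := rnorm_ge0 g; lra.
have pG : norm_positive (scal (rnorm g + 1) - g).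
  by apply: norm_positive_scal_sub => //; lra.
exists (rnorm g + 1)^-1; first by rewrite invr_gt0.
have -> : p - scal (rnorm g + 1)^-1 =
    scal (rnorm g + 1)^-1 * ((scal (rnorm g + 1) - g) * p).
  by rewrite mulrBl gp mulrBr mulr1 mulrA -scalM mulVf ?gt_eqF // scal1 mul1r.
apply: norm_positiveM.
- by apply: norm_positive_scal; rewrite invr_ge0 ltW.
- apply: norm_positiveM => //; apply/commr_sym/commrB; first exact: comm_scal.
  by rewrite /GRing.comm pg gp.
- by rewrite /GRing.comm scalC.
Qed.

End SquareRoots.

(** * Norm positivity against spectral positivity, and absolute values *)

Section Positivity.
Local Open Scope complex_scope.
Context {R : realType} {A : cstarAlgType R}.
Implicit Types (g x y z : A) (t : R).

(** Neumann series: [u] runs through its partial sums, dominated by the geometric sums [s]. *)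
Lemma invertible_one_sub z t : rnorm z <= t -> t < 1 -> invertible (1 - z).
Proof.
move=> zt t1; have t0 : 0 <= t by apply: le_trans zt; exact: rnorm_ge0.
pose u n := iter n (fun y => 1 + z * y) (0 : A).
pose s n := iter n (fun r : R => 1 + t * r) 0.
have uS n : u n.+1 = 1 + z * u n by [].
have sS n : s n.+1 = 1 + t * s n by [].
have u_comm n : GRing.comm z (u n).
  elim: n => [|n IH]; first exact: commr0.
  by rewrite uS; apply: commrD; [exact: commr1 | apply: commrM].
have du n : rnorm (u n.+1 - u n) <= s n.+1 - s n.
  elim: n => [|n IH].
    by rewrite uS sS /u /s /= !mulr0 !addr0 !subr0 rnorm1.
  have -> : u n.+2 - u n.+1 = z * (u n.+1 - u n).
    by rewrite [u n.+2]uS [in X in _ - X]uS opprD addrACA subrr add0r -mulrBr.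
  have -> : s n.+2 - s n.+1 = t * (s n.+1 - s n) by rewrite !sS; ring.
  by apply: le_trans (ler_rnormM _ _) _; rewrite ler_pM ?rnorm_ge0.
have sB n : s n <= (1 - t)^-1.
  rewrite -[leRHS]mul1r ler_pdivlMr ?subr_gt0 //.
  elim: n => [|n IH]; first by rewrite /s /= mul0r.
  by have := ler_wpM2l t0 IH; rewrite sS; lra.
have [l ul] := dominated_cvg du sB.
have zl : GRing.comm z l by apply: (rnorm_cvg_comm ul).
have lE : l = 1 + z * l.
  apply/eqP; rewrite -subr_eq0; apply/eqP.
  apply: (@rnorm_cvg_eq0 _ _ u l _ 1 ul) => n.
  have -> : l - (1 + z * l) = (l - u n.+1) - z * (l - u n).
    by rewrite uS mulrBr -[RHS]addrA -opprD -[in RHS]addrA subrKC.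
  have := ler_rnormD (l - u n.+1) (- (z * (l - u n))); rewrite rnormN.
  have := ler_rnormM z (l - u n).
  have := ler_wpM2r (rnorm_ge0 (l - u n)) (le_trans zt (ltW t1)).
  by lra.
exists l; split.
  by rewrite mulrBl mul1r {1}lE addrK.
by rewrite mulrBr mulr1 -(zl : _ = _) {1}lE addrK.
Qed.

Lemma invertible_mul_comm x y : GRing.comm x y -> invertible (x * y) ->
  invertible x.
Proof.
move=> xy [g [xyg gxy]]; exists (y * g); split; first by rewrite mulrA.
have yx : (g * y) * x = 1 by rewrite -mulrA -xy.
rewrite -[y * g]mul1r -{1}yx -[g * y * x * _]mulrA [x * (y * g)]mulrA xyg.
by rewrite mulr1.
Qed.

Lemma invertible_scal_sub z t : rnorm z < t -> invertible (scal t - z).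
Proof.
move=> zt; have t0 : 0 < t by apply: le_lt_trans zt; exact: rnorm_ge0.
have tn0 : t != 0 by rewrite gt_eqF.
have : rnorm (scal t^-1 * z) <= t^-1 * rnorm z.
  by rewrite rnorm_scalM ger0_norm // invr_ge0 ltW.
move=> /invertible_one_sub; rewrite ltr_pdivrMl // mulr1 => /(_ zt)[g [g1 g2]].
have zE : scal t - z = scal t * (1 - scal t^-1 * z).
  by rewrite mulrBr mulr1 scalKV.
exists (scal t^-1 * g); rewrite zE !scal_mulACA mulfV // mulVf // g1 g2.
by rewrite scal1 mulr1.
Qed.

(** [x + t] is [(r + t) - (r - x)], and [r - x] has norm at most [r < r + t]. *)
Lemma invertible_add_scal x t : norm_positive x -> 0 < t ->
  invertible (x + scal t).
Proof.
move=> [_ [r r0 xr]] t0.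
have -> : x + scal t = scal (r + t) - (scal r - x).
  by rewrite scalD opprB [x - _]addrC addrACA subrr add0r addrC.
by apply: invertible_scal_sub; lra.
Qed.

(** Off the real line, with [y = x - a], the product of [y - i b] and [y + i b] is
    [y ^+ 2 + b ^+ 2], which is invertible. For real [a < 0], [x - a] is [x] plus a positive
    scalar. *)
Lemma norm_positive_positive x : norm_positive x -> positive x.
Proof.
move=> px; have [sx _] := px; split=> // -[a b] kx /=.
have kE : (a +i* b) *: (1 : A) = scal a + (b *i) *: (1 : A).
  by rewrite /scal -scalerDl; congr (_ *: _); apply/eqP; rewrite eq_complex /=
    addr0 add0r !eqxx.
have [b0|b0] := eqVneq b 0; last first.
  exfalso; apply: kx; rewrite kE opprD addrA.
  set y := x - scal a; have sy : self_adjoint y.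
    by apply: self_adjointB => //; exact: self_adjoint_scal.
  have yb : GRing.comm y ((b *i) *: (1 : A)).
    by rewrite /GRing.comm -cstar_scaleAr -cstar_scaleAl mulr1 mul1r.
  apply: (@invertible_mul_comm _ (y + (b *i) *: (1 : A))).
    apply/commrD; last first.
      by apply/commr_sym/commrB; [exact: commr_sym | exact: commr_refl].
    by apply/commr_sym/commrB => //; exact: commr_refl.
  rewrite mulrBD_comm // -cstar_scaleAr mulr1 scalerA.
  have -> : (b *i) * (b *i) = - (b * b)%:C.
    by apply/eqP; rewrite eq_complex /=; simpc.
  rewrite scaleNr opprK; apply: invertible_add_scal.
    exact: norm_positive_sqr.
  by rewrite -expr2 exprn_even_gt0.
rewrite b0 in kx *; rewrite ler0c leNgt; apply/negP => a0; apply: kx.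
have -> : x - a%:C *: (1 : A) = x + scal (- a) by rewrite scalN.
by apply: invertible_add_scal => //; rewrite oppr_gt0.
Qed.

(* The least [k >= 0] with [x + k] norm positive must be 0: were it positive,
   [x + k] would be invertible and [k] could be decreased. *)
Lemma positive_norm_positive x : positive x -> norm_positive x.
Proof.
move=> [sx xpos].
pose S := [set k : R | 0 <= k /\ norm_positive (x + scal k)]%classic.
have lbS : has_lbound S by exists 0 => k [].
have infS : has_inf S.
  split=> //; exists (rnorm x); split; first exact: rnorm_ge0.
  split; first by apply: self_adjointD => //; exact: self_adjoint_scal.
  exists (rnorm x); first exact: rnorm_ge0.
  by rewrite opprD addrCA subrr addr0 rnormN.
set k0 := inf S.
have k00 : 0 <= k0 by apply: lb_le_inf; [case: infS | move=> k []].
(* The infimum is attained: for [k] in [S] close to [k0], [rnorm_scal_sub] gives the witness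
   [rnorm x + k0 + e / 2], and the error [e] is arbitrary. *)
have pk0 : norm_positive (x + scal k0).
  split; first by apply: self_adjointD => //; exact: self_adjoint_scal.
  exists (rnorm x + k0); first by rewrite addr_ge0 ?rnorm_ge0.
  apply/ler_addgt0Pr => e e0.
  have e20 : 0 < e / 2 by rewrite divr_gt0.
  have [k [k_ge0 pk] kk0] := inf_adherent e20 infS.
  have k0k : k0 <= k by apply: ge_inf.
  have xk : rnorm (x + scal k) <= rnorm x + k0 + e / 2.
    have := ler_rnormD x (scal k); have := @rnorm_scal _ A k.
    by rewrite ger0_norm //; lra.
  have := rnorm_scal_sub pk xk.
  have -> : scal (rnorm x + k0) - (x + scal k0) =
    (scal (rnorm x + k0 + e / 2) - (x + scal k)) + scal (k - k0 - e / 2).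
    rewrite !opprD !addrA [LHS]addrAC -scalB [_ - x - scal k]addrAC -scalB.
    by rewrite [RHS]addrAC -scalD; congr (scal _ - x); ring.
  have := ler_rnormD (scal (rnorm x + k0 + e / 2) - (x + scal k))
    (scal (k - k0 - e / 2)).
  have := @rnorm_scal _ A (k - k0 - e / 2).
  have : `|k - k0 - e / 2| <= e / 2 by rewrite ler_norml; lra.
  by lra.
move: (k00); rewrite le_eqVlt => /orP[/eqP k0E|k0_gt0].
  by move: pk0; rewrite -k0E scal0 addr0.
(* Otherwise [- k0] would be a negative point of the spectrum. *)
have inv_k0 : invertible (x + scal k0).
  apply: contrapT => ninv; have /xpos : spectrum x (- k0)%:C.
    by rewrite /spectrum /= -/(scal _) scalN opprK.
  by rewrite /= ler0c oppr_ge0 leNgt k0_gt0.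
have [e e0 pe] := norm_positive_decr pk0 inv_k0.
pose d := Num.min e k0.
have d0 : 0 < d by rewrite lt_min e0.
have de : d <= e by rewrite ge_min lexx.
have dk : d <= k0 by rewrite ge_min lexx orbT.
have : S (k0 - d).
  split; first by rewrite subr_ge0.
  have -> : x + scal (k0 - d) = (x + scal k0 - scal e) + scal (e - d).
    by rewrite !scalB !addrA subrK.
  by apply: norm_positiveD => //; apply: norm_positive_scal; rewrite subr_ge0.
by move=> /(ge_inf lbS); rewrite -/k0; lra.
Qed.

Lemma positiveP x : positive x <-> norm_positive x.
Proof.
by split; [exact: positive_norm_positive | exact: norm_positive_positive].
Qed.

(** The root [y] rules out the default value of [xget], and uniqueness identifies the chosen root
    with [y]. *)
Lemma psqrtP x y : positive y -> y * y = x -> psqrt x = y.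
Proof.
move=> py yx.
have [ps ss] : positive (psqrt x) /\ psqrt x ^+ 2 = x.
  by apply: (@xgetPex _ 0 [set s | positive s /\ s ^+ 2 = x]%classic); exists y.
by apply: sqrt_uniq; [exact/positiveP.. | rewrite yx -expr2].
Qed.

Lemma absval_sa x : self_adjoint x ->
  positive (absval x) /\ absval x * absval x = x * x.
Proof.
move=> sx; have [s [/positiveP ps sE _]] := norm_positive_sqrt
  (norm_positive_sqr sx).
by rewrite /absval sx (psqrtP ps sE).
Qed.

Lemma absvalP x y : self_adjoint x -> positive y -> y * y = x * x ->
  absval x = y.
Proof. by move=> sx py yx; rewrite /absval sx; apply: psqrtP. Qed.

Lemma max_normE x y : max_norm x y = (Num.max (rnorm x) (rnorm y))%:C.
Proof.
rewrite /max_norm !rnormE /Order.max ltcR.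
by case: ifP.
Qed.

End Positivity.

(** * Absolute compatibility and the Jordan product *)

Theorem corollary4p8 (R : realType) (A : cstarAlgType R) (a b : A)
    (ha : positive a) (hb : positive b) :
  abs_compatible a b <-> jordan a b = max_norm a b *: dotwedge a b.
Proof.
have [[sa _] [sb _]] := (ha, hb).
pose t := Num.max (rnorm a) (rnorm b).
have at_ : rnorm a <= t by rewrite le_max lexx.
have bt : rnorm b <= t by rewrite le_max lexx orbT.
have t0 : 0 <= t by apply: le_trans at_; exact: rnorm_ge0.
have st := @self_adjoint_scal R A t.
rewrite /abs_compatible /jordan /dotwedge max_normE -/t -/(scal t).
set u := a - b; set v := a + b - scal t.
have su : self_adjoint u by apply: self_adjointB.
have sv : self_adjoint v by apply: self_adjointB => //; apply: self_adjointD.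
have [pu uE] := absval_sa su; have [pv vE] := absval_sa sv.
set m := absval u in pu uE *.
(* [- t <= - b <= a - b <= a <= t], so [t^2 - u^2 = (t - u) (t + u) >= 0] *)
have u_le : rnorm u <= t.
  have ptu : norm_positive (scal t - u).
    rewrite opprB addrCA addrC; apply: norm_positiveD.
      exact: norm_positive_scal_sub.
    exact/positiveP.
  have ptu' : norm_positive (scal t + u).
    rewrite /u addrCA; apply: norm_positiveD.
      exact/positiveP.
    exact: norm_positive_scal_sub.
  have tu : GRing.comm (scal t) u by rewrite /GRing.comm scalC.
  have : rnorm (u * u) <= t * t.
    apply: norm_positive_le; rewrite ?mulr_ge0 //; first
      exact: norm_positive_sqr.
    rewrite scalM -mulrBD_comm //; apply: norm_positiveM => //.
    apply/commr_sym/commrB; last exact/commr_sym/commrD.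
    by rewrite /GRing.comm scalC.
  by rewrite rnorm_sqr // -expr2 ler_pXn2r // nnegrE ?rnorm_ge0.
(* The C*-identity and [m * m = u * u] give [m] the norm of [u], at most [t]. *)
have pt : positive (scal t - m).
  have [sm _] := pu; apply/positiveP/norm_positive_scal_sub => //.
  apply: le_trans u_le; rewrite -(ler_pXn2r (isT : (0 < 2)%N)) ?nnegrE
    ?rnorm_ge0 //.
  by rewrite -!rnorm_sqr // uE.
(* Both squares contain [u * u + scal t * scal t]; what remains differs by four times the difference
   of the two sides of the Jordan equation. *)
have key : v * v = (scal t - m) * (scal t - m) <->
  (2^-1 : R[i]) *: (a * b + b * a) =
  t%:C%C *: ((2^-1 : R[i]) *: (a + b - m)).
  rewrite scalerA mulrC -scalerA -[t%:C%C *: _]scalE.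
  set w := a * b + b * a; set r := scal t * (a + b - m).
  have -> : v * v = u * u + scal t * scal t +
      (w + w - (scal t * (a + b) + scal t * (a + b))).
    rewrite sqrB_comm; last by rewrite /GRing.comm scalC.
    by rewrite [(a + b) * scal t]scalC sqrD_sqrB -/u -/w
      [_ + (w + w) + _]addrAC -[LHS]addrA.
  have -> : (scal t - m) * (scal t - m) = u * u + scal t * scal t +
      - (scal t * m + scal t * m).
    by rewrite sqrB_comm ?uE 1?[_ + u * u]addrC // /GRing.comm scalC.
  have rE : r + r =
      scal t * (a + b) + scal t * (a + b) - (scal t * m + scal t * m).
    by rewrite /r mulrBr addrACA -opprD.
  split.
    move=> /addrI/eqP; rewrite subr_eq [- _ + _]addrC -rE => /eqP wr.
    congr (_ *: _).
    by rewrite -(scal_halfD w) -mulrDr wr mulrDr scal_halfD.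
  move=> /(congr1 (fun x => (2 : R[i]) *: x)).
  rewrite !scalerA mulfV ?pnatr_eq0 // !scale1r => ->.
  congr (_ + _); apply/eqP; rewrite subr_eq [- _ + _]addrC -rE //.
(* Compatibility reads [absval v = scal t - m]: squaring gives one direction, uniqueness of the
   positive root the other. *)
rewrite -key; split.
  by move=> h; rewrite -vE -h [m + _]addrC addrK.
by move=> h; rewrite (absvalP sv pt) ?h // addrC subrK.
Qed.
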